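(* Let $I\subset\mathbb R$ be a non-degenerate interval, let $N\ge 1$ be an integer and let $a_0,\ldots,a_N\in\mathbb R$ with $a_0\ne 0$ and $a_N\neq 0$. Assume that $$\mathcal R(a_N,\ldots,a_0)=\{(1,1),(r_1,k_1),(r_2,k_2),(\lambda_1,l_1),\ldots,(\lambda_p,l_p)\},$$ that $$|r_1|<|\lambda_1|\le\ldots\le|\lambda_p|<|r_2|,$$ and that $r_1,r_2$ are real with $r_1r_2<0$. Let $g\colon I\to I$ be a continuous surjection which is either increasing or decreasing. Let $j\in\{1,2\}$ be the index of the negative number among $r_1$ and $r_2$ if $g$ is decreasing, and the index of the positive number among $r_1$ and $r_2$ if $g$ is increasing. Let $b_Mr^M+\ldots+b_1r+b_0$ be a polynomial with real coefficients, $b_M\ne0$, such that $$\mathcal R(b_M,\ldots,b_0)=\{(1,1),(r_j,k_j),(\lambda_1,l_1),\ldots,(\lambda_p,l_p)\}.$$ Then $g$ satisfies $$a_Ng^N(x)+\ldots+a_1g(x)+a_0x=0\quad\text{for all }x\in I$$ if and only if it satisfies $$b_Mg^M(x)+\ldots+b_1g(x)+b_0x=0\quad\text{for all }x\in I.$$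
   Context: $g^n$ denotes the $n$-th iterate of $g$. For real numbers $c_0,\ldots,c_K$ with $c_K\neq0$, $\mathcal R(c_K,\ldots,c_0)$ denotes the set $\{(r_1,k_1),\ldots,(r_s,k_s)\}$ of all pairs consisting of a complex root of the polynomial $c_Kr^K+\ldots+c_1r+c_0$ and its multiplicity, where $r_1,\ldots,r_s$ are the pairwise distinct complex roots. In particular $1$ is a simple root and is distinct from $r_1,r_2$ and all $\lambda_i$. The $\lambda_i$ are complex numbers (real or not). Here $p\ge 0$; for $p=0$ the inequality chain reads $|r_1|<|r_2|$. *)

(* Defs.v *)
From HB Require Import structures.
From mathcomp Require Import all_boot all_order all_algebra.
From mathcomp Require Import complex.
From mathcomp Require Import all_classical all_reals all_analysis.

Set Implicit Arguments.
Unset Strict Implicit.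
Unset Printing Implicit Defensive.

Import Order.TTheory GRing.Theory Num.Theory.
Import numFieldNormedType.Exports.

Local Open Scope classical_set_scope.
Local Open Scope ring_scope.
Local Open Scope complex_scope.

(* c_K X^K + ... + c_1 X + c_0, with its real coefficients seen in R[i];
   only c 0, ..., c K matter. *)
Definition cpoly (R : realType) (K : nat) (c : nat -> R) : {poly R[i]} :=
  \poly_(n < K.+1) (c n)%:C.

Definition roots_mult (R : realType) (K : nat) (c : nat -> R) :
    set (R[i] * nat) :=
  [set z | root (cpoly K c) z.1 /\ z.2 = mup z.1 (cpoly K c)].

(* The elements of [s] list the pairs (root, multiplicity); the roots listed
   are pairwise distinct, so that e.g. a root 1 cannot be listed twice. *)
Definition roots_mult_listed (R : realType) (K : nat) (c : nat -> R)
    (s : seq (R[i] * nat)) : Prop :=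
  uniq (unzip1 s) /\ roots_mult K c = [set z | z \in s].

Definition nondegenerate_set (R : realType) (I : set R) : Prop :=
  exists x y, [/\ I x, I y & x < y].

Definition increasing_on (R : realType) (I : set R) (g : R -> R) : Prop :=
  forall x y, I x -> I y -> x < y -> g x < g y.

Definition decreasing_on (R : realType) (I : set R) (g : R -> R) : Prop :=
  forall x y, I x -> I y -> x < y -> g y < g x.

(* c_K g^K(x) + ... + c_1 g(x) + c_0 x = 0 on I, where g^n is the n-th
   iterate. *)
Definition iterative_eq (R : realType) (I : set R) (g : R -> R)
    (K : nat) (c : nat -> R) : Prop :=
  forall x, I x -> \sum_(n < K.+1) c n * iter n g x = 0.

(* Main.v *)
(** As g is bijective on I, each x in I lies on a two-sided orbit X : int -> I,
    and both equations become annihilation of all orbits by polynomials in the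
    shift S. Let rho be the root to be eliminated. The differences
    d n = X (n + 1) - X n have constant sign if g increases (then rho < 0) and
    alternate in sign if g decreases (then rho > 0), so d n / rho ^ n alternates.
    By Bezout, d = e + f with e killed by the other factors and f killed by
    (S - rho)^k. In the direction where rho dominates (n -> +oo if rho = r_2,
    n -> -oo if rho = r_1), e n = o(rho ^ n), whereas f n / rho ^ n is a
    polynomial in n, hence is zero or ultimately bounded away from 0 with
    constant sign. The alternation excludes the latter. *)

Require Import Defs.
From HB Require Import structures.
From mathcomp Require Import all_boot all_order all_algebra.
From mathcomp Require Import complex.
From mathcomp Require Import all_classical all_reals all_analysis.
From mathcomp Require Import ring lra zify.

Set Implicit Arguments.
Unset Strict Implicit.
Unset Printing Implicit Defensive.

Import Order.TTheory GRing.Theory Num.Theory.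
Import numFieldNormedType.Exports.

Local Open Scope classical_set_scope.
Local Open Scope ring_scope.
Local Open Scope complex_scope.

(** * Polynomials in the shift acting on two-sided sequences *)

Section ShiftAction.
Variable F : comNzRingType.
Implicit Types (p q : {poly F}) (u v : int -> F) (n : int) (c : F).

(* p(S) u, where (S u) n = u (n + 1) *)
Definition shift_act p u n : F := \sum_(i < size p) p`_i * u (n + i%:Z).

Lemma shift_act_wide m p u n : (size p <= m)%N ->
  shift_act p u n = \sum_(i < m) p`_i * u (n + i%:Z).
Proof.
move=> le_pm; rewrite /shift_act (big_ord_widen m (fun i => p`_i * u (n + i%:Z))) //.
rewrite big_mkcond; apply: eq_bigr => i _; case: ltnP => // le_pi.
by rewrite nth_default ?mul0r.
Qed.

Lemma eq_shift_act p u v : u =1 v -> shift_act p u =1 shift_act p v.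
Proof. by move=> eq_uv n; apply: eq_bigr => i _; rewrite eq_uv. Qed.

Lemma shift_actD p q u n :
  shift_act (p + q) u n = shift_act p u n + shift_act q u n.
Proof.
pose m := maxn (size p) (size q).
rewrite !(@shift_act_wide m) ?size_polyD ?leq_maxl ?leq_maxr //.
by rewrite -big_split; apply: eq_bigr => i _; rewrite coefD mulrDl.
Qed.

Lemma shift_actZ c p u n : shift_act (c *: p) u n = c * shift_act p u n.
Proof.
rewrite (@shift_act_wide (size p)) ?size_scale_leq // mulr_sumr.
by apply: eq_bigr => i _; rewrite coefZ mulrA.
Qed.

Lemma shift_actMX p u n : shift_act (p * 'X) u n = shift_act p u (n + 1).
Proof.
rewrite (@shift_act_wide (size p).+1); last first.
  by rewrite (leq_trans (size_polyMleq _ _)) // size_polyX addn2.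
rewrite big_ord_recl coefMX /= mul0r add0r; apply: eq_bigr => i _.
by rewrite coefMX /= -addrA -PoszD.
Qed.

Lemma shift_actC c u n : shift_act c%:P u n = c * u n.
Proof.
by rewrite (@shift_act_wide 1) ?size_polyC_leq1 // big_ord1 coefC addr0.
Qed.

Lemma shift_act0r p n : shift_act p (fun=> 0) n = 0.
Proof. by apply: big1 => i _; rewrite mulr0. Qed.

Lemma shift_actZr p c u n :
  shift_act p (fun m => c * u m) n = c * shift_act p u n.
Proof. by rewrite mulr_sumr; apply: eq_bigr => i _; rewrite mulrCA. Qed.

(** Makes two-sided sequences a module over the polynomials, so that factors can be split off one at
    a time. Induction on the Horner form of [p]. *)
Lemma shift_actM p q u n : shift_act (p * q) u n = shift_act p (shift_act q u) n.
Proof.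
elim/poly_ind: p n => [|p c IHp] n.
  by rewrite mul0r /shift_act size_poly0 !big_ord0.
rewrite mulrDl mulrAC !shift_actD !shift_actMX IHp mul_polyC shift_actZ.
by rewrite shift_actC.
Qed.

Lemma shift_act_XsubC c u n : shift_act ('X - c%:P) u n = u (n + 1) - c * u n.
Proof.
by rewrite -['X]mul1r -polyCN shift_actD shift_actMX !shift_actC mul1r mulNr.
Qed.

Lemma shift_act_eq0_mul p q u :
  shift_act q u =1 (fun=> 0) -> shift_act (p * q) u =1 (fun=> 0).
Proof. by move=> qu0 n; rewrite shift_actM (eq_shift_act _ qu0) shift_act0r. Qed.

End ShiftAction.

(** Both polynomials split, and equal multiplicities make their lists of roots permutations of each
    other. *)
Lemma eqp_mup (F : closedFieldType) (p q : {poly F}) :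
  p != 0 -> q != 0 -> (forall z, mup z p = mup z q) -> p %= q.
Proof.
move=> p_neq0 q_neq0 eq_mup.
have [s def_p] := closed_field_poly_normal p.
have [t def_q] := closed_field_poly_normal q.
have lp : lead_coef p != 0 by rewrite lead_coef_eq0.
have lq : lead_coef q != 0 by rewrite lead_coef_eq0.
have mupZ c (p1 : {poly F}) z : c != 0 -> mup z (c *: p1) = mup z p1.
  by move=> c_neq0; rewrite -mul_polyC mupMr // rootC.
have eq_st : perm_eq s t.
  apply/allP => z _; move: (eq_mup z).
  by rewrite def_p def_q !mupZ // !mu_prod_XsubC => eq_st; apply/eqP.
rewrite def_p def_q (perm_big _ eq_st) /=.
by rewrite (eqp_trans (eqp_scale _ lp)) // eqp_sym eqp_scale.
Qed.

(** * Sequences compared with powers of [rho] along a half-line *)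

(* [ray true] runs to -oo, [ray false] to +oo *)
Definition ray (s : bool) (m : nat) : int := if s then - m%:Z else m%:Z.

Definition scaled (F : fieldType) (rho : F) (s : bool) (u : int -> F) (m : nat) :=
  u (ray s m) / rho ^ ray s m.

(** Solves [v = (S - c) u] for the next term along the ray. Going forward multiplies by [c], going
    backward divides by it, hence [c != 0] for [s] only. *)
Lemma scaled_shift (F : fieldType) (rho c : F) (s : bool) (u : int -> F) m :
    rho != 0 -> (s -> c != 0) ->
    let v := scaled rho s (shift_act ('X - c%:P) u) in
  scaled rho s u m.+1 =
    if s then rho / c * scaled rho s u m - c^-1 * v m.+1
    else c / rho * scaled rho s u m + rho^-1 * v m.
Proof.
move=> rho_neq0 c_neq0; rewrite /scaled; case: s c_neq0 => /= c_neq0;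
  rewrite shift_act_XsubC.
  have -> : - m.+1%:Z + 1 = - m%:Z by lia.
  have c0 := c_neq0 isT.
  have -> : rho ^ (- m%:Z) = rho * rho ^ (- m.+1%:Z).
    by rewrite -[X in X * _]expr1z -expfzDr //; congr (_ ^ _); lia.
  have : rho ^ (- m.+1%:Z) != 0 by rewrite expfz_neq0.
  move: (rho ^ _) => t t_neq0; field.
  by rewrite t_neq0 rho_neq0 c0.
have -> : rho ^ m.+1 = rho * rho ^ m by rewrite -exprSz.
have -> : m%:Z + 1 = m.+1 by lia.
have : rho ^ m != 0 by rewrite expfz_neq0.
move: (rho ^ m) => t t_neq0; field.
by rewrite t_neq0 rho_neq0.
Qed.

(** * Decay of sequences whose characteristic roots are dominated *)

Section Decay.
Variable R : realType.
Local Notation C := R[i].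

Definition null (e : nat -> C) : Prop :=
  forall eps : R, 0 < eps -> exists N, forall n, (N <= n)%N -> `|e n| < eps%:C.

Lemma affine_rec_lt (q : R) (a h : nat -> R) : 0 <= q < 1 ->
  (forall n, a n.+1 <= q * a n + h n) ->
  (forall eps, 0 < eps -> exists N, forall n, (N <= n)%N -> h n < eps) ->
  forall eps, 0 < eps -> exists N, forall n, (N <= n)%N -> a n < eps.
Proof.
move=> /andP[q_ge0 q_lt1] a_rec h_small eps eps_gt0.
(* The bound is chosen so that [eps / 2] is the fixed point of [x |-> q * x + eps * (1 - q) / 2];
   the excess of [a] over it then shrinks by the factor [q]. *)
have [N h_lt] := h_small (eps * (1 - q) / 2) ltac:(nra).
have a_le m : a (N + m)%N - eps / 2 <= geometric `|a N - eps / 2| q m.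
  rewrite /geometric /=; elim: m => [|m IHm]; first by rewrite addn0 expr0 mulr1 ler_norm.
  have := a_rec (N + m)%N; have := h_lt (N + m)%N (leq_addr _ _).
  rewrite addnS exprS; move: IHm; nra.
have q_norm : `|q| < 1 by rewrite ger0_norm.
have /cvgrPdist_lt/(_ (eps / 2) ltac:(lra))[M _ geo_lt] :=
  @cvg_geometric R `|a N - eps / 2| q q_norm.
exists (N + M)%N => n le_n.
have := geo_lt (n - N)%N; rewrite /= sub0r normrN => /(_ ltac:(lia)).
move=> /(le_lt_trans (ler_norm _)).
have := a_le (n - N)%N; rewrite subnKC; last lia.
by rewrite /geometric /=; lra.
Qed.

Lemma normc_Re (z : C) : `|z| = (complex.Re `|z|)%:C.
Proof. by rewrite RRe_real // normr_real. Qed.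

Lemma Re_norm_ge0 (z : C) : 0 <= complex.Re `|z|.
Proof. by rewrite -ler0c -normc_Re. Qed.

Lemma nullM (c : C) e : null e -> null (fun n => c * e n).
Proof.
move=> null_e eps eps_gt0.
(* The added 1 keeps the divisor positive when [c] is 0. *)
have den_gt0 : 0 < complex.Re `|c| + 1 by rewrite ltr_wpDl ?Re_norm_ge0.
have [N e_lt] := null_e _ (divr_gt0 eps_gt0 den_gt0).
exists N => n /e_lt; rewrite normrM (normc_Re c) (normc_Re (e n)) -rmorphM !ltcR.
rewrite ltr_pdivlMr // => lt_eps; apply: le_lt_trans lt_eps.
by rewrite mulrC ler_wpM2l ?lerDl ?Re_norm_ge0.
Qed.

Lemma nullS e : null e -> null (fun n => e n.+1).
Proof.
by move=> null_e eps /null_e[N e_lt]; exists N => n le_n; apply: e_lt; lia.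
Qed.

Lemma null_rec (q : C) (e h : nat -> C) : `|q| < 1 -> null h ->
  (forall n, e n.+1 = q * e n + h n) -> null e.
Proof.
rewrite (normc_Re q) -[1]/(1%:C) ltcR => q_lt1 null_h e_rec eps eps_gt0.
have : forall x, 0 < x -> exists N, forall n, (N <= n)%N -> complex.Re `|e n| < x.
  apply: (@affine_rec_lt (complex.Re `|q|) _ (fun n => complex.Re `|h n|)) => [|n|x x_gt0].
  - by rewrite q_lt1 Re_norm_ge0.
  - by rewrite -lecR rmorphD rmorphM -!normc_Re e_rec -normrM ler_normD.
  - by have [N h_lt] := null_h x x_gt0; exists N => n /h_lt; rewrite normc_Re ltcR.
by move=> /(_ eps eps_gt0)[N e_lt]; exists N => n /e_lt; rewrite [`|e n|]normc_Re ltcR.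
Qed.

(* [z ^ n = o(rho ^ n)] as n runs along [ray s] *)
Definition dominated (rho : C) (s : bool) (z : C) :=
  if s then `|rho| < `|z| else `|z| < `|rho|.

(** In the recurrence of [scaled_shift] with [c = z], the ratio [z / rho] or [rho / z] has modulus
    below 1 by dominance, so [null_rec] applies. *)
Lemma null_scaled_XsubC (rho z : C) s u : rho != 0 -> dominated rho s z ->
  null (scaled rho s (shift_act ('X - z%:P) u)) -> null (scaled rho s u).
Proof.
move=> rho_neq0 dom null_v.
have z_neq0 : s -> z != 0.
  by case: (s) dom => //= lt_z _; rewrite -normr_gt0 (le_lt_trans _ lt_z).
have rec m := scaled_shift u m rho_neq0 z_neq0.
case: s dom null_v z_neq0 rec => /= dom null_v z_neq0 rec.
  apply: (null_rec _ (nullM (- z^-1) (nullS null_v))); last first.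
    by move=> n; rewrite rec mulNr.
  by rewrite normf_div ltr_pdivrMr ?mul1r // (le_lt_trans _ dom).
apply: (null_rec _ (nullM rho^-1 null_v) rec).
by rewrite normf_div ltr_pdivrMr ?mul1r // normr_gt0.
Qed.

(** [Q] splits into linear factors. If the product over [z :: t] kills [u], the product over [t]
    kills [(S - z) u], which is null by induction; then so is [u]. *)
Lemma null_scaled_annihilated (rho : C) s (Q : {poly C}) u :
    rho != 0 -> Q != 0 -> (forall z, root Q z -> dominated rho s z) ->
  shift_act Q u =1 (fun=> 0) -> null (scaled rho s u).
Proof.
move=> rho_neq0 Q_neq0 dom.
have [t def_Q] := closed_field_poly_normal Q.
have lQ : lead_coef Q != 0 by rewrite lead_coef_eq0.
have dom_t z : z \in t -> dominated rho s z.
  by move=> zt; apply: dom; rewrite def_Q rootZ // root_prod_XsubC.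
move=> Qu; have {Qu} : shift_act (\prod_(z <- t) ('X - z%:P)) u =1 (fun=> 0).
  by move=> n; have := Qu n; rewrite def_Q shift_actZ => /eqP;
  rewrite mulf_eq0 (negPf lQ) => /eqP.
elim: t dom_t u {def_Q} => [|z t IHt] dom_t u.
  rewrite big_nil => u0 eps eps_gt0; exists 0 => n _; rewrite /scaled.
  by have := u0 (ray s n); rewrite shift_actC mul1r => ->; rewrite mul0r normr0 ltcR.
rewrite big_cons mulrC => Qu.
apply: (null_scaled_XsubC rho_neq0 (dom_t z (mem_head _ _))).
apply: IHt => [y yt|n]; first by rewrite dom_t // in_cons yt orbT.
by rewrite -shift_actM.
Qed.

(** * Sign of sequences killed by a power of [S - rho] *)

(** Holds for every nonzero real polynomial sequence and is stable under summation, which spares any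
    explicit polynomial in [n]. *)
Definition ultimately_signed (F : nat -> R) : Prop :=
  exists (c : R) (N : nat), 0 < c /\
    ((forall n, (N <= n)%N -> c <= F n) \/ (forall n, (N <= n)%N -> F n <= - c)).

Lemma ultimately_signedN F :
  ultimately_signed F -> ultimately_signed (fun n => - F n).
Proof.
move=> [c [N [c_gt0 [F_ge | F_le]]]]; exists c, N; split=> //.
  by right=> n /F_ge; rewrite lerN2.
by left=> n /F_le; rewrite lerNr.
Qed.

Lemma ultimately_signedM a F : a != 0 ->
  ultimately_signed F -> ultimately_signed (fun n => a * F n).
Proof.
move=> a_neq0 [c [N [c_gt0 F_ge]]]; exists (`|a| * c), N.
split; first by rewrite mulr_gt0 ?normr_gt0.
case: (ltrgt0P a) a_neq0 => // a_sgn _; case: F_ge => F_ge;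
  [left|right|right|left] => n /F_ge; nra.
Qed.

Lemma ultimately_signedS F :
  ultimately_signed F -> ultimately_signed (fun n => F n.+1).
Proof.
move=> [c [N [c_gt0 F_ge]]]; exists c, N; split=> //.
by case: F_ge => F_ge; [left|right] => n le_n; apply: F_ge; lia.
Qed.

Lemma ultimately_signed_sum F G : (forall n, F n.+1 = F n + G n) ->
  ultimately_signed G -> ultimately_signed F.
Proof.
suff pos F' G' c N : 0 < c -> (forall n, F' n.+1 = F' n + G' n) ->
    (forall n, (N <= n)%N -> c <= G' n) -> ultimately_signed F'.
  move=> FS [c [N [c_gt0 [G_ge | G_le]]]]; first exact: (pos F G c N).
  have : ultimately_signed (fun n => - F n).
    apply: (pos _ (fun n => - G n) c N) => // n; first by rewrite FS opprD.
    by move=> /G_le; rewrite lerNr.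
  by move=> /ultimately_signedN; under eq_fun do rewrite opprK.
move=> c_gt0 FS G_ge.
have F_ge m : F' N + c * m%:R <= F' (N + m)%N.
  elim: m => [|m IHm]; first by rewrite mulr0 addr0 addn0.
  rewrite addnS FS -natr1; have := G_ge (N + m)%N (leq_addr _ _); lra.
(* After [K] increments of size at least [c], the sum has passed 1, whatever its value at [N]. *)
pose K := (Num.truncn ((1 - F' N) / c)).+1.
have K_gt : (1 - F' N) / c < K%:R by rewrite truncnS_gt.
exists 1, (N + K)%N; split => //; left => n le_n.
have := F_ge (n - N)%N; rewrite subnKC; last lia.
apply: le_trans; rewrite -lerBlDl; move: K_gt; rewrite ltr_pdivrMr // => K_gt.
have : K%:R <= (n - N)%:R :> R by rewrite ler_nat; lia.
by nra.
Qed.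

(** After division by powers of [rho], the operator [S - rho] is a difference operator up to a
    nonzero constant and an index shift, so undoing it is a summation. *)
Lemma ultimately_signed_scaled_XsubC (rho : R) s u : rho != 0 ->
  ultimately_signed (scaled rho s (shift_act ('X - rho%:P) u)) ->
  ultimately_signed (scaled rho s u).
Proof.
move=> rho_neq0 sgn_v.
have rec m := scaled_shift u m rho_neq0 (fun _ : s => rho_neq0).
case: s sgn_v rec => /= sgn_v rec.
  apply: (ultimately_signed_sum _ (ultimately_signedM _ (ultimately_signedS sgn_v))).
    by move=> n; rewrite rec divff // mul1r -mulNr.
  by rewrite oppr_eq0 invr_eq0.
apply: (ultimately_signed_sum _ (ultimately_signedM _ sgn_v)).
  by move=> n; rewrite rec divff // mul1r.
by rewrite invr_eq0.
Qed.

Lemma Re_annihilated_XsubC_exp (rho : R) s k (f : int -> C) : rho != 0 ->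
  shift_act (('X - (rho%:C)%:P) ^+ k) f =1 (fun=> 0) ->
  (forall n, complex.Re (f n) = 0)
  \/ ultimately_signed (scaled rho s (fun n => complex.Re (f n))).
Proof.
move=> rho_neq0; elim: k f => [|k IHk] f fP.
  by left=> n; have := fP n; rewrite expr0 shift_actC mul1r => ->.
pose g n := complex.Re (f n).
(* Since [rho] is real, taking real parts commutes with [S - rho]. *)
have gP n : complex.Re (shift_act ('X - (rho%:C)%:P) f n) = shift_act ('X - rho%:P) g n.
  rewrite !shift_act_XsubC /g; case: (f n) (f (n + 1)) => [a b] [c d] /=.
  by rewrite mul0r subr0.
have [|g0|] := IHk (shift_act ('X - (rho%:C)%:P) f).
- by move=> n; rewrite -shift_actM -exprSr.
(* Both rays start at index 0, so the constant is [g 0] on each of them; if it vanishes, [g]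
   vanishes on all integers. *)
- have g_const s' m : scaled rho s' g m = g 0.
    elim: m => [|m <-]; first by rewrite /scaled /ray; case: s'; rewrite ?oppr0 divr1.
    rewrite (scaled_shift _ _ rho_neq0 (fun=> rho_neq0)) /scaled -!gP !g0.
    by rewrite !mul0r !mulr0 subr0 addr0 divff // mul1r; case: s'.
  case: (ltrgt0P (g 0)) => [g_gt0|g_lt0|g_eq0].
  + by right; exists (g 0), 0%N; split=> //; left=> n _; rewrite g_const.
  + right; exists (- g 0), 0%N; split; first by rewrite oppr_gt0.
    by right=> n _; rewrite g_const opprK.
  + left=> n; have : g n / rho ^ n = 0.
      have [m [->|->]] : exists m : nat, n = m%:Z \/ n = - m%:Z.
        by exists `|n|%N; lia.
      * by rewrite -g_eq0 -(g_const false m).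
      * by rewrite -g_eq0 -(g_const true m).
    by move/eqP; rewrite mulf_eq0 invr_eq0 (negPf (expfz_neq0 n rho_neq0)) orbF => /eqP.
- move=> sgn; right; apply: ultimately_signed_scaled_XsubC => //.
  by move: sgn; congr ultimately_signed; apply/funext => m; rewrite /scaled gP.
Qed.

Lemma scaled_Re (rho : R) s (f : int -> C) m :
  scaled rho s (fun n => complex.Re (f n)) m = complex.Re (scaled (rho%:C) s f m).
Proof.
rewrite /scaled -fmorphXz -fmorphV; case: (f _) => a b /=.
by rewrite mulr0 subr0.
Qed.

Lemma null_Re e : null e ->
  forall eps : R, 0 < eps -> exists N, forall n, (N <= n)%N -> `|complex.Re (e n)| < eps.
Proof.
move=> null_e eps /null_e[N e_lt]; exists N => n /e_lt.
by rewrite -ltcR; apply: le_lt_trans; apply: normc_ge_Re.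
Qed.

(** * Removal of the factor [(X - rho) ^ k] by alternation *)

Lemma annihilated_alternating (rho : R) s k (Q : {poly C}) (u : int -> R) :
    rho != 0 -> Q != 0 -> (forall z, root Q z -> dominated rho%:C s z) ->
    (forall n, rho * (u n * u (n + 1)) <= 0) ->
    shift_act (Q * ('X - (rho%:C)%:P) ^+ k) (fun n => (u n)%:C) =1 (fun=> 0) ->
  shift_act Q (fun n => (u n)%:C) =1 (fun=> 0).
Proof.
move=> rho_neq0 Q_neq0 dom u_alt QPu.
set P := ('X - (rho%:C)%:P) ^+ k in QPu; set v : int -> C := fun n => (u n)%:C.
have rhoC_neq0 : rho%:C != 0 by rewrite fmorph_eq0.
(* Dominance is strict, so [rho] is not a root of [Q]. *)
have /Bezout_eq1_coprimepP[[al be] /= bezout] : coprimep P Q.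
  rewrite coprimep_expl // coprimep_sym coprimep_XsubC.
  by apply/negP => /dom; rewrite /dominated ltxx if_same.
pose e := shift_act (al * P) v; pose f := shift_act (be * Q) v.
have vE n : v n = e n + f n by rewrite -shift_actD bezout shift_actC mul1r.
have Qe : shift_act Q e =1 (fun=> 0).
  by move=> n; rewrite -shift_actM mulrCA shift_act_eq0_mul.
have Pf : shift_act P f =1 (fun=> 0).
  by move=> n; rewrite -shift_actM mulrCA [P * Q]mulrC shift_act_eq0_mul.
have null_e : null (scaled rho%:C s e) := null_scaled_annihilated rhoC_neq0 Q_neq0 dom Qe.
have Ref n : complex.Re (f n) = 0.
  have [//|[c [N [c_gt0 f_sgn]]]] := Re_annihilated_XsubC_exp s rho_neq0 Pf.
  have [N' e_lt] := null_Re null_e c_gt0.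
  pose w := scaled rho s u.
  have wE m : w m = complex.Re (scaled rho%:C s e m) +
      scaled rho s (fun n => complex.Re (f n)) m.
    rewrite -scaled_Re /w /scaled -mulrDl; congr (_ / _).
    by have /(congr1 (@complex.Re R)) := vE (ray s m); rewrite raddfD.
  (* Up to a square, this product is [rho * (u n * u (n + 1))] for the smaller index [n] of the
     two. *)
  have w_alt m : w m * w m.+1 <= 0.
    rewrite /w /scaled; case: (s) => /=.
      have := u_alt (- m.+1%:Z); have -> : - m.+1%:Z + 1 = - m%:Z by lia.
      have -> : rho ^ (- m%:Z) = rho * rho ^ (- m.+1%:Z).
        by rewrite -[X in X * _]expr1z -expfzDr //; congr (_ ^ _); lia.
      have : rho ^ (- m.+1%:Z) != 0 by rewrite expfz_neq0.
      move: (rho ^ _) => t t_neq0 uu_le0.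
      have -> : u (- m%:Z) / (rho * t) * (u (- m.+1%:Z) / t) =
          rho * (u (- m.+1%:Z) * u (- m%:Z)) * (rho * t)^-1 ^+ 2.
        by field; rewrite t_neq0 rho_neq0.
      by rewrite mulr_le0_ge0 // sqr_ge0.
    have := u_alt m; have -> : m%:Z + 1 = m.+1 by lia.
    have -> : rho ^ m.+1 = rho * rho ^ m by rewrite -exprSz.
    have : rho ^ m != 0 by rewrite expfz_neq0.
    move: (rho ^ m) => t t_neq0 uu_le0.
    have -> : u m / t * (u m.+1 / (rho * t)) =
        rho * (u m * u m.+1) * (rho * t)^-1 ^+ 2.
      by field; rewrite t_neq0 rho_neq0.
    by rewrite mulr_le0_ge0 // sqr_ge0.
  (* At [K] and [K.+1] the part from [e] is smaller than [c] and the part from [f] has size at least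
     [c] with a fixed sign, so [w K * w K.+1 > 0]. *)
  pose K := maxn N N'.
  have := w_alt K; rewrite !wE.
  have := e_lt K (leq_maxr _ _); have := e_lt K.+1 (leqW (leq_maxr _ _)).
  case: f_sgn => f_sgn; have := f_sgn K (leq_maxl _ _);
    have := f_sgn K.+1 (leqW (leq_maxl _ _)).
    rewrite !ltr_norml; nra.
  rewrite !ltr_norml; nra.
(* Imaginary parts are handled through ['i * f]. As [v] is real, the real parts of ['i * e] and
   ['i * f] cancel, but the first is small and the second would be bounded away from 0. *)
have Rei n : complex.Re ('i * f n) = 0.
  have iPf : shift_act P (fun n => 'i * f n) =1 (fun=> 0).
    by move=> m; rewrite shift_actZr Pf mulr0.
  have [//|[c [N [c_gt0 f_sgn]]]] := Re_annihilated_XsubC_exp s rho_neq0 iPf.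
  have [N' e_lt] := null_Re (nullM 'i null_e) c_gt0.
  pose K := maxn N N'.
  have : scaled rho s (fun n => complex.Re ('i * e n)) K +
      scaled rho s (fun n => complex.Re ('i * f n)) K = 0.
    rewrite /scaled -mulrDl; apply/eqP; rewrite mulf_eq0; apply/orP; left.
    have -> : complex.Re ('i * e (ray s K)) + complex.Re ('i * f (ray s K)) =
      complex.Re (v (ray s K) * 'i) by rewrite vE mulrDl raddfD ![_ * 'i]mulrC.
    by rewrite ReiNIm oppr0.
  have := e_lt K (leq_maxr _ _).
  have -> : 'i * scaled rho%:C s e K = scaled rho%:C s (fun n => 'i * e n) K.
    by rewrite /scaled mulrA.
  rewrite -scaled_Re ltr_norml.
  by case: f_sgn => /(_ K (leq_maxl _ _)); lra.
have f0 n : f n = 0.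
  have := Rei n; rewrite mulrC ReiNIm => /eqP; rewrite oppr_eq0 => /eqP Imf.
  by rewrite [f n]complexE Ref Imf mulr0 addr0.
by move=> n; rewrite -(Qe n); apply: eq_shift_act => m; rewrite vE f0 addr0.
Qed.

End Decay.

(** * Multiplicities read off from lists of roots *)

Section RootLists.
Variable R : realType.
Implicit Types (K : nat) (c : nat -> R) (s : seq (R[i] * nat)).

Lemma cpoly_neq0 K c : c K != 0 -> cpoly K c != 0.
Proof.
move=> cK_neq0; have : (cpoly K c)`_K != 0.
  by rewrite coef_poly ltnSn fmorph_eq0.
by apply: contraNneq => ->; rewrite coef0.
Qed.

Lemma roots_mult_listedP K c s t : roots_mult_listed K c s ->
  t \in s <-> root (cpoly K c) t.1 /\ t.2 = mup t.1 (cpoly K c).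
Proof.
by move=> [_ /(congr1 (fun A => A t)) /= mem_t]; rewrite -[X in X <-> _]mem_t.
Qed.

(** The listed roots are distinct, so at most one term is present. The form as a sum is invariant
    under permutation and splits on [cons]. *)
Lemma mup_roots_mult_listed K c s z : roots_mult_listed K c s ->
  mup z (cpoly K c) = (\sum_(t <- s | t.1 == z) t.2)%N.
Proof.
move=> listed_s; have memP t := roots_mult_listedP t listed_s.
have [z_root|z_nroot] := boolP (root (cpoly K c) z); last first.
  rewrite mupNroot // big1_seq // => t /andP[/eqP tz /memP[]].
  by rewrite tz (negPf z_nroot).
have zs : (z, mup z (cpoly K c)) \in s by apply/memP.
rewrite big_mkcond (bigD1_seq _ zs) ?(map_uniq (proj1 listed_s)) //= eqxx.
rewrite big1_seq ?addn0 // => -[y m] /andP[/= ne /memP /= [_ mE]].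
by case: eqP => // yz; rewrite mE yz eqxx in ne.
Qed.

End RootLists.

(** * Two-sided orbits and the iterative equation *)

Section Orbits.
Variables (R : realType) (I : set R) (g : R -> R).

Definition is_orbit (X : int -> R) : Prop :=
  forall n, I (X n) /\ X (n + 1) = g (X n).

Lemma orbit_iter X n i : is_orbit X -> X (n + i%:Z) = iter i g (X n).
Proof.
move=> orbX; elim: i => [|i /= <-]; first by rewrite addr0.
by rewrite -(orbX _).2 -addrA; congr (X (_ + _)); lia.
Qed.

Lemma orbit_exists x : set_fun I I g -> set_surj I I g -> I x ->
  exists2 X, is_orbit X & X 0 = x.
Proof.
move=> g_fun g_surj Ix.
have /choice[h hP] : forall y, exists z, I y -> I z /\ g z = y.
  (* [h] selects preimages inside [I]; outside [I] its value is a dummy. *)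
  move=> y; have [Iy|nIy] := pselect (I y); last by exists y.
  by have [z Iz gz] := g_surj y Iy; exists z.
have I_iter_h m : I (iter m h x) by elim: m => //= m /hP[].
(* [Negz m] is [- (m + 1)], hence [m.+1] backward steps. *)
exists (fun n => match n with Posz m => iter m g x | Negz m => iter m.+1 h x end) => //.
case=> [m|[|m]].
- by rewrite -PoszD addn1; split=> //; elim: m => //= m; apply: g_fun.
- by split; [exact: (I_iter_h 1%N) | rewrite /= (hP x Ix).2].
- have -> : Negz m.+1 + 1 = Negz m by lia.
  by split; [exact: (I_iter_h m.+2) | rewrite [in RHS]/= (hP _ (I_iter_h m.+1)).2].
Qed.

(** The action at index [n] is the left-hand side of the equation at [X n], and every point of [I]
    is the term 0 of some orbit. *)
Lemma iterative_eq_orbit K c : set_fun I I g -> set_surj I I g ->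
  iterative_eq I g K c <->
  forall X, is_orbit X -> shift_act (cpoly K c) (fun n => (X n)%:C) =1 (fun=> 0).
Proof.
move=> g_fun g_surj.
have actE X n : is_orbit X -> shift_act (cpoly K c) (fun n => (X n)%:C) n =
    (\sum_(i < K.+1) c i * iter i g (X n))%:C.
  move=> orbX; rewrite (shift_act_wide _ _ (size_poly _ _)) rmorph_sum /=.
  by apply: eq_bigr => i _; rewrite coef_poly ltn_ord rmorphM orbit_iter.
split=> [eq_c X orbX n | act_c x Ix].
  by rewrite actE // eq_c //; have [] := orbX n.
have [X orbX <-] := orbit_exists g_fun g_surj Ix.
by apply: complexI; rewrite -actE // act_c.
Qed.

End Orbits.

(** * Elimination of one real root from the equation *)

(** Common core of both cases. The sign pattern belongs to the differences of an orbit, not to the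
    orbit, so one factor [X - 1] is spent on forming them. *)
Lemma iterative_eq_eliminate (R : realType) (I : set R) (g : R -> R)
    (N M : nat) (a b : nat -> R) (sA sB : seq (R[i] * nat))
    (rho : R) (k : nat) (s : bool) :
    set_fun I I g -> set_surj I I g -> a N != 0 -> b M != 0 ->
    roots_mult_listed N a sA -> roots_mult_listed M b sB ->
    perm_eq sA ((rho%:C, k) :: sB) -> (1, 1%N) \in sB -> rho != 0 ->
    (forall t, t \in sB -> t.1 != 1 -> dominated rho%:C s t.1) ->
    increasing_on I g /\ rho < 0 \/ decreasing_on I g /\ 0 < rho ->
  iterative_eq I g N a <-> iterative_eq I g M b.
Proof.
move=> g_fun g_surj aN_neq0 bM_neq0 listA listB permAB B1 rho_neq0 dom g_mono.
have PA_neq0 := cpoly_neq0 aN_neq0; have PB_neq0 := cpoly_neq0 bM_neq0.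
set PA := cpoly N a in PA_neq0; set PB := cpoly M b in PB_neq0.
pose P : {poly R[i]} := ('X - (rho%:C)%:P) ^+ k.
have P_neq0 : P != 0 by rewrite expf_neq0 // polyXsubC_eq0.
have /eqpf_eq[c c_neq0 PAE] : PA %= PB * P.
  apply: eqp_mup => // [|z]; first by rewrite mulf_neq0.
  rewrite mupM // mup_XsubCX (mup_roots_mult_listed _ listA).
  rewrite (mup_roots_mult_listed _ listB) (perm_big _ permAB) big_cons /=.
  by case: ifP; rewrite ?addn0 // addnC.
have orbP := iterative_eq_orbit _ _ g_fun g_surj.
split=> /orbP act0; apply/orbP => X orbX; last first.
  (* The easy direction: [PA] is a multiple of [PB]. *)
  move=> n; rewrite -/PA PAE shift_actZ mulrC [PB * P]mulrC shift_act_eq0_mul ?mul0r //.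
  exact: act0.
have [PB1 mupPB1] := (roots_mult_listedP (1, 1%N) listB).1 B1.
have /dvdpP[Q PBE] : 'X - 1%:P %| PB by rewrite dvdp_XsubCl.
have Q_neq0 : Q != 0 by apply: contraNneq PB_neq0 => Q0; rewrite PBE Q0 mul0r.
(* The root 1 of [PB] is simple. Thus every root of [Q] differs from 1 and falls under [dom]. *)
have Q1 : ~~ root Q 1.
  rewrite -dvdp_XsubCl XsubC_dvd // -eqn0Ngt; apply/eqP.
  move: mupPB1; rewrite /= -/PB PBE mupM ?polyXsubC_eq0 //.
  by rewrite -['X - _]expr1 mup_XsubCX eqxx addn1 => -[<-].
pose d n := X (n + 1) - X n.
have dE n : (d n)%:C = shift_act ('X - 1%:P) (fun n => (X n)%:C) n.
  by rewrite shift_act_XsubC mul1r rmorphB.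
rewrite -/PB PBE => n; rewrite shift_actM -(eq_shift_act _ dE).
move: n; apply: (@annihilated_alternating _ rho s k) => // [z Qz|n|n].
- have zB : (z, mup z PB) \in sB.
    by apply/(roots_mult_listedP _ listB); rewrite /= -/PB PBE rootM Qz.
  by apply: (dom _ zB); apply: contraNneq Q1 => /= <-.
- have [In Xn1] := orbX n; have [In1 Xn2] := orbX (n + 1).
  have -> : d (n + 1) = g (X (n + 1)) - g (X n) by rewrite /d Xn2 Xn1.
  (* Consecutive differences have the same sign if [g] increases and opposite signs if it decreases;
     the sign of [rho] makes the product nonpositive either way. *)
  rewrite /d; case: (ltgtP (X n) (X (n + 1))) => [lt_X|lt_X|->]; last first.
  + by rewrite subrr mul0r mulr0.
  + case: g_mono => -[/(_ _ _ In1 In lt_X) lt_g rho_sgn].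
      by rewrite nmulr_rle0 // mulr_le0 ?subr_le0 // ltW.
    by rewrite pmulr_rle0 // mulr_le0_ge0 ?subr_le0 ?subr_ge0 // ltW.
  + case: g_mono => -[/(_ _ _ In In1 lt_X) lt_g rho_sgn].
      by rewrite nmulr_rle0 // mulr_ge0 ?subr_ge0 // ltW.
    by rewrite pmulr_rle0 // mulr_ge0_le0 ?subr_le0 ?subr_ge0 // ltW.
- rewrite (eq_shift_act _ dE) -shift_actM mulrAC -PBE.
  by have /eqP := act0 X orbX n; rewrite -/PA PAE shift_actZ mulf_eq0;
  rewrite (negPf c_neq0) => /eqP.
Qed.

Theorem theorem4p3 (R : realType) (I : set R)
  (I_itv : is_interval I) (I_nondeg : nondegenerate_set I)
  (N : nat) (N_ge1 : (1 <= N)%N) (a : nat -> R)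
  (a0_neq0 : a 0%N != 0) (aN_neq0 : a N != 0)
  (* r_1, r_2 are r ord0, r ord_max *)
  (r : 'I_2 -> R) (k : 'I_2 -> nat)
  (p : nat) (lam : 'I_p -> R[i]) (l : 'I_p -> nat)
  (roots_a : roots_mult_listed N a
     [:: (1, 1%N), ((r ord0)%:C, k ord0), ((r ord_max)%:C, k ord_max)
       & [seq (lam i, l i) | i <- enum 'I_p]])
  (r1_lt_r2 : `|r ord0| < `|r ord_max|)
  (r1_lt_lam : forall i, `|(r ord0)%:C| < `|lam i|)
  (lam_le : forall i1 i2 : 'I_p, (i1 <= i2)%N -> `|lam i1| <= `|lam i2|)
  (lam_lt_r2 : forall i, `|lam i| < `|(r ord_max)%:C|)
  (r1r2_lt0 : r ord0 * r ord_max < 0)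
  (g : R -> R) (g_fun : set_fun I I g) (g_surj : set_surj I I g)
  (g_cont : {within I, continuous g})
  (g_mono : increasing_on I g \/ decreasing_on I g)
  (j : 'I_2)
  (j_decr : decreasing_on I g -> r j < 0)
  (j_incr : increasing_on I g -> 0 < r j)
  (M : nat) (b : nat -> R) (bM_neq0 : b M != 0)
  (roots_b : roots_mult_listed M b
     [:: (1, 1%N), ((r j)%:C, k j) & [seq (lam i, l i) | i <- enum 'I_p]]) :
  iterative_eq I g N a <-> iterative_eq I g M b.
Proof.
pose L := [seq (lam i, l i) | i <- enum 'I_p].
(* The eliminated root has the sign opposite to [r j], as [iterative_eq_eliminate] requires. *)
have sign_elim (rho : R) : r j * rho < 0 ->
    increasing_on I g /\ rho < 0 \/ decreasing_on I g /\ 0 < rho.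
  by case: g_mono => mono; [left|right]; split=> //;
    [have := j_incr mono | have := j_decr mono]; nra.
have r_neq0 i : r i != 0.
  apply: contraTneq r1r2_lt0 => ri0.
  have [i0|i1] : i = ord0 \/ i = ord_max.
    by case: i {ri0} => -[|[|//]] ?; [left|right]; apply: val_inj.
    by rewrite -i0 ri0 mul0r ltxx.
  by rewrite -i1 ri0 mulr0 ltxx.
have normC (x : R) : `|x%:C| = `|x|%:C by rewrite normc_def /= expr0n addr0 sqrtr_sqr.
have [j0|j1] : j = ord0 \/ j = ord_max.
- by case: j {j_decr j_incr roots_b sign_elim} => -[|[|//]] ?; [left|right]; apply: val_inj.
(* Here [r_2] is eliminated; it has the largest modulus, so the ray to +oo is used. *)
- rewrite j0 in roots_b sign_elim.
  apply: (@iterative_eq_eliminate _ _ _ _ _ _ _ _ _ (r ord_max) (k ord_max) false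
    g_fun g_surj aN_neq0 bM_neq0 roots_a roots_b) => //.
  + by rewrite (perm_catCA [:: _; _] [:: _] L).
  + by rewrite mem_head.
  + move=> t; rewrite !inE => /or3P[/eqP->|/eqP->|/mapP[i _ ->]] //=.
      by rewrite eqxx.
    by rewrite /dominated !normC ltcR.
  + exact: sign_elim.
(* Here [r_1] is eliminated; it has the smallest modulus, so the ray to -oo is used. *)
- rewrite j1 in roots_b sign_elim.
  apply: (@iterative_eq_eliminate _ _ _ _ _ _ _ _ _ (r ord0) (k ord0) true
    g_fun g_surj aN_neq0 bM_neq0 roots_a roots_b) => //.
  + by rewrite (perm_catCA [:: _] [:: _] (_ :: L)).
  + by rewrite mem_head.
  + move=> t; rewrite !inE => /or3P[/eqP->|/eqP->|/mapP[i _ ->]] //=.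
      by rewrite eqxx.
    by rewrite /dominated !normC ltcR.
  + by apply: sign_elim; rewrite mulrC.
Qed.
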